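(* Let $\mathfrak C$ be a finitely aligned, left cancellative, countable small category and $\mathfrak S$ a Garside family in $\mathfrak C$ with $\mathfrak S \cap \mathfrak C^* = \emptyset$ which is $=^*$-transverse and locally bounded. Let $I_l\ltimes\Omega$ be the groupoid model for $C^*_\lambda(\mathfrak C)$. Then there is a one-to-one correspondence between closed invariant subspaces of $I_l\ltimes\Omega$ (that is, closed invariant subspaces of its unit space $\Omega$) and admissible, $H$-invariant, $\max_{\preceq}^{\infty}$-closed pairs $(\mathfrak T,\mathfrak D)$ with $\mathfrak T\subseteq\mathfrak S$ and $\mathfrak D\subseteq\mathfrak C^0$.
   Context: **Categories.** $\mathfrak C$ denotes the set of morphisms of a small category, $\mathfrak C^0\subseteq\mathfrak C$ the set of identity morphisms (identified with the objects), $\mathfrak d,\mathfrak t:\mathfrak C\to\mathfrak C^0$ the domain and target maps; $cd$ is defined iff $\mathfrak d(c)=\mathfrak t(d)$. $\mathfrak C$ is left cancellative if $cx=cy$ implies $x=y$. $\mathfrak C^*$ is the set of invertible elements. For $c\in\mathfrak C$ and $S\subseteq\mathfrak C$, $cS=\{cs: s\in S,\ \mathfrak t(s)=\mathfrak d(c)\}$. $\mathfrak C$ is finitely aligned if for all $a,b\in\mathfrak C$ there is a finite $F\subseteq\mathfrak C$ with $a\mathfrak C\cap b\mathfrak C=\bigcup_{c\in F}c\mathfrak C$. **Groupoid.** Each $c\in\mathfrak C$ gives the partial bijection $\mathfrak d(c)\mathfrak C\to c\mathfrak C$, $x\mapsto cx$; $I_l$ is the smallest semigroup of partial bijections of $\mathfrak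 C$ containing these and closed under inverses; $\mathcal J=\{\mathrm{dom}(s):s\in I_l\}$ is its semilattice of idempotents (product = intersection). $\widehat{\mathcal J}$ is the space of non-zero multiplicative maps $\chi:\mathcal J\to\{0,1\}$ with $\chi(\emptyset)=0$ if $\emptyset\in\mathcal J$ (topology of pointwise convergence). $\Omega\subseteq\widehat{\mathcal J}$ is the subspace of those $\chi$ such that whenever $e=\bigcup_{i=1}^n f_i$ with $e,f_1,\dots,f_n\in\mathcal J$ and $\chi(e)=1$, then $\chi(f_i)=1$ for some $i$. $s\in I_l$ acts by $\{\chi\in\Omega:\chi(s^{-1}s)=1\}\to\{\chi\in\Omega:\chi(ss^{-1})=1\}$, $\chi\mapsto s.\chi=\chi(s^{-1}\,\cdot\, s)$, and $I_l\ltimes\Omega$ is the corresponding transformation groupoid (classes $[s,\chi]$ with $\chi(s^{-1}s)=1$; $[s,\chi]=[t,\chi]$ iff $se=te$ for some $e\in\mathcal J$ with $\chi(e)=1$; source $\chi$, range $s.\chi$). A subset $X\subseteq\Omega$ is invariant iff $s.\chi\in X$ whenever $s\in I_l$, $\chi\in X$ and $\chi(s^{-1}s)=1$. $C^*_\lambda(\mathfrak C)\subseteq\mathcal L(\ell^2\mathfrak C)$ is the C*-algebra generated by the partial isometries $\lambda_c$ ($c\in\mathfrak C$), where $\lambda_c\delta_x=\delta_{cx}$ if $\mathfrak t(x)=\mathfrak d(c)$ and $\lambda_c\delta_x=0$ otherwise. **Garside families.** $a\preceq b$ means $b\in a\mathfrak C$; $a\prec b$ means $b\mathfrak C\subsetneq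 a\mathfrak C$; $a=^*b$ means $a\in b\mathfrak C^*$; $a$ is a right divisor of $b$ if $b\in\mathfrak Ca$. $\mathfrak S$ is $=^*$-transverse if $s_1,s_2\in\mathfrak S$, $s_1=^*s_2$ imply $s_1=s_2$. $\mathfrak S$ is locally bounded if for every $\mathfrak v\in\mathfrak C^0$ there is no infinite sequence $s_1\prec s_2\prec\cdots$ in $\mathfrak v\mathfrak S$. A path is a finite or infinite sequence $s_1s_2\cdots$ in $\mathfrak C$ with $\mathfrak d(s_k)=\mathfrak t(s_{k+1})$ for all $k$. Put $\mathfrak S^\sharp=\mathfrak S\mathfrak C^*\cup\mathfrak C^*$. $\mathfrak S$ is a Garside family if: (1) it is closed under right comultiples (for $r,s\in\mathfrak S$, $a\in\mathfrak C$ with $r\preceq a$, $s\preceq a$ there is $t\in\mathfrak S$ with $r\preceq t$, $s\preceq t$, $t\preceq a$); (2) $\mathfrak S\cup\mathfrak C^*$ generates $\mathfrak C$; (3) $\mathfrak S^\sharp$ is closed under right divisors; (4) every $a\in\mathfrak C$ equals $s_1\cdots s_l$ for some normal path $s_1\cdots s_l$ in $\mathfrak S^\sharp$, where a path $s_1s_2\cdots$ in $\mathfrak S^\sharp$ is normal if for all $k$ (for which $s_{k+1}$ is defined) and all $r\in\mathfrak S$, $r\preceq s_ks_{k+1}$ implies $r\preceq s_k$. For $a\in\mathfrak C\setminus\mathfrak C^*$, $H(a)$ denotes the unique $s\in\mathfrak S$ with $s\preceq a$ such that every $r\in\mathfrak S$ with $r\preceq a$ satisfies $r\preceq s$. **Limits.**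 For a sequence $(s_i)$ in $\mathfrak S$ and $s\in\mathfrak S\cup\mathfrak C^0$, write $\lim_i s_i=s$ if $s$ is maximal with respect to $\preceq$ among $\{r\in\mathfrak S\cup\mathfrak C^0: r\preceq s_i\text{ for almost all }i\}$. **Conditions on pairs** $(\mathfrak T,\mathfrak D)$ with $\mathfrak T\subseteq\mathfrak S$, $\mathfrak D\subseteq\mathfrak C^0$: - admissible: for every $t\in\mathfrak T$, there is $t'\in\mathfrak T$ such that $tt'$ is normal, or $\mathfrak d(t)\in\mathfrak D$; - $H$-invariant: for all $a\in\mathfrak C\setminus\mathfrak C^*$ and $x\in\mathfrak T\cup\mathfrak D$ with $\mathfrak d(a)=\mathfrak t(x)$, $H(ax)$ lies in $\mathfrak T$; - $\max_\preceq^\infty$-closed: for every sequence $(t_i)$ in $\mathfrak T$, if $\lim_i t_i$ exists in $\mathfrak S$, then $\lim_i t_i\in\mathfrak T\cup\mathfrak D$.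
   Formalization: The literal claim fails, so the conditions on pairs are corrected: D must also be stable under isomorphism of objects; limits in max-closedness may be objects, not only elements of S; and a limit must be the limit of every subsequence as well. *)

(* Defs.v *)
From mathcomp Require Import all_boot all_order all_algebra.
From mathcomp Require Import all_classical all_reals all_analysis.

Set Implicit Arguments.
Unset Strict Implicit.
Unset Printing Implicit Defensive.

Local Open Scope classical_set_scope.

(* A small category given by its set of morphisms; an object is identified
   with its identity morphism.  ccomp is total, but ccomp a b is meaningful only
   when dom a = tgt b: no axiom constrains it otherwise. *)
Record category : Type := Category {
  mor :> Type;
  dom : mor -> mor;
  tgt : mor -> mor;
  ccomp : mor -> mor -> mor;
  dom_dom : forall a, dom (dom a) = dom a;
  tgt_dom : forall a, tgt (dom a) = dom a;
  dom_tgt : forall a, dom (tgt a) = tgt a;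
  tgt_tgt : forall a, tgt (tgt a) = tgt a;
  dom_ccomp : forall a b, dom a = tgt b -> dom (ccomp a b) = dom b;
  tgt_ccomp : forall a b, dom a = tgt b -> tgt (ccomp a b) = tgt a;
  ccompA : forall a b c, dom a = tgt b -> dom b = tgt c ->
    ccomp a (ccomp b c) = ccomp (ccomp a b) c;
  ccomp1c : forall a, ccomp (tgt a) a = a;
  ccompc1 : forall a, ccomp a (dom a) = a
}.

Arguments dom {_} _.
Arguments tgt {_} _.
Arguments ccomp {_} _ _.

Section Category.
Variable C : category.
Implicit Types (a b c r s t u v x y : C) (S T D : set C).

Definition objects : set C := [set v | dom v = v].

Definition left_cancellative : Prop :=
  forall c x y, dom c = tgt x -> dom c = tgt y -> ccomp c x = ccomp c y -> x = y.

Definition invertible : set C :=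
  [set c | exists b, [/\ dom c = tgt b, dom b = tgt c,
                         ccomp c b = tgt c & ccomp b c = dom c]].

Definition lmulset c S : set C :=
  [set y | exists s, [/\ S s, dom c = tgt s & y = ccomp c s]].

Definition rideal c : set C := lmulset c setT.

Definition finitely_aligned : Prop :=
  forall a b, exists F : set C,
    finite_set F /\ rideal a `&` rideal b = \bigcup_(c in F) rideal c.

Definition ldivides a b : Prop := rideal a b.

Definition sldivides a b : Prop := rideal b `<` rideal a.

Definition eqstar a b : Prop := lmulset b invertible a.

Definition rdivides a b : Prop := exists x, dom x = tgt a /\ b = ccomp x a.

(* Partial maps of C are represented by their graphs: s x y means s(x) = y. *)

Definition partial_map : Type := C -> C -> Prop.

Definition pm_inv (s : partial_map) : partial_map := fun x y => s y x.

Definition pm_comp (s t : partial_map) : partial_map := fun x z => exists2 y, t x y & s y z.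

Definition pm_dom (s : partial_map) : set C := [set x | exists y, s x y].

Definition lmul_map c : partial_map := fun x y => dom c = tgt x /\ y = ccomp c x.

Inductive left_inverse_hull : partial_map -> Prop :=
| hull_lmul c : left_inverse_hull (lmul_map c)
| hull_inv (s : partial_map) : left_inverse_hull s -> left_inverse_hull (pm_inv s)
| hull_comp (s t : partial_map) : left_inverse_hull s -> left_inverse_hull t ->
    left_inverse_hull (pm_comp s t).

(* An idempotent of the inverse hull is identified with its domain. *)
Definition is_constructible (e : set C) : Prop :=
  exists2 s : partial_map, left_inverse_hull s & e = pm_dom s.

Definition constructible : Type := {e : set C | is_constructible e}.

Lemma pullback_subproof (s : partial_map) (e : constructible) : left_inverse_hull s ->
  is_constructible [set x | exists2 y, s x y & sval e y].
Proof.
case: e => e [t ht def_e] /= hs; exists (pm_comp t s); first exact: hull_comp.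
rewrite def_e predeqE => x; split=> /=.
  by case=> y sxy [z tyz]; exists z, y.
by case=> z [y sxy tyz]; exists y => //; exists z.
Qed.

Definition pullback (s : partial_map) (hs : left_inverse_hull s) (e : constructible) : constructible :=
  exist _ _ (pullback_subproof e hs).

(* Maps from the semilattice of constructible ideals to {0,1}, with the
   topology of pointwise convergence. *)
Definition Jmap : Type := {ptws constructible -> bool}.

(* When C is left cancellative, constructible ideals are stable under
   intersection, so g below exists for all e and f. *)
Definition multiplicative (chi : Jmap) : Prop :=
  forall e f g : constructible, sval g = sval e `&` sval f -> chi g = chi e && chi f.

Definition characters : set Jmap :=
  [set chi | [/\ exists e, chi e = true, multiplicative chi &
                 forall e, sval e = set0 -> chi e = false]].

Definition Omega : set Jmap :=
  [set chi | characters chi /\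
    forall (n : nat) (e : constructible) (f : 'I_n.+1 -> constructible),
      sval e = \bigcup_i sval (f i) -> chi e = true ->
      exists i, chi (f i) = true].

(* s^-1 e s is the idempotent with domain {x | s(x) is defined and in e}. *)
Definition act (s : partial_map) (hs : left_inverse_hull s) (chi : Jmap) : Jmap :=
  fun e => chi (pullback hs e).

Definition invariant_set (X : set Jmap) : Prop :=
  forall (s : partial_map) (hs : left_inverse_hull s) (chi : Jmap) (e : constructible),
    X chi -> sval e = pm_dom s -> chi e = true -> X (act hs chi).

Definition closed_invariant (X : set Jmap) : Prop :=
  [/\ X `<=` Omega, closed (X : set (subspace Omega)) & invariant_set X].

Definition transverse S : Prop :=
  forall s1 s2, S s1 -> S s2 -> eqstar s1 s2 -> s1 = s2.

Definition locally_bounded S : Prop :=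
  forall v, objects v ->
    ~ exists s_ : nat -> C,
        forall n, lmulset v S (s_ n) /\ sldivides (s_ n) (s_ n.+1).

Definition sharp S : set C :=
  [set x | exists s, S s /\ lmulset s invertible x] `|` invertible.

Definition closed_right_comultiple S : Prop :=
  forall r s a, S r -> S s -> ldivides r a -> ldivides s a ->
    exists t, [/\ S t, ldivides r t, ldivides s t & ldivides t a].

Definition closed_right_divisor S : Prop :=
  forall a b, S b -> rdivides a b -> S a.

Definition generates (G : set C) : Prop :=
  forall P : set C, G `<=` P ->
    (forall a b, P a -> P b -> dom a = tgt b -> P (ccomp a b)) -> P = setT.

(* Nonempty finite paths are given by their first entry and the sequence of
   the remaining ones. *)
Fixpoint path_prod (s : C) (p : seq C) : C :=
  if p is t :: p' then ccomp s (path_prod t p') else s.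

Fixpoint is_path (s : C) (p : seq C) : Prop :=
  if p is t :: p' then dom s = tgt t /\ is_path t p' else True.

Fixpoint all_in (A : set C) (s : C) (p : seq C) : Prop :=
  if p is t :: p' then A s /\ all_in A t p' else A s.

Fixpoint greedy S (s : C) (p : seq C) : Prop :=
  if p is t :: p' then
    (forall r, S r -> ldivides r (ccomp s t) -> ldivides r s) /\ greedy S t p'
  else True.

Definition normal_path S (s : C) (p : seq C) : Prop :=
  [/\ is_path s p, all_in (sharp S) s p & greedy S s p].

Definition garside S : Prop :=
  [/\ closed_right_comultiple S,
      generates (S `|` invertible),
      closed_right_divisor (sharp S) &
      forall a, exists s p, normal_path S s p /\ a = path_prod s p].

(* h = H(a) *)
Definition is_head S a h : Prop :=
  [/\ S h, ldivides h a & forall r, S r -> ldivides r a -> ldivides r h].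

Definition is_lim S (s_ : nat -> C) s : Prop :=
  let A := [set r | (S `|` objects) r /\ \forall i \near \oo, ldivides r (s_ i)]
  in A s /\ forall r, A r -> ~ sldivides s r.

(* is_lim alone is not stable under passing to subsequences: in the free
   abelian monoid on x and y, with S = {x, y, xy}, it makes 1 the limit of
   x, y, x, y, ...  A limit is said to exist when it is also the limit of every
   subsequence.  It may be an object, as for a sequence of pairwise distinct
   generators of a free monoid. *)
Definition lim_exists S (s_ : nat -> C) s : Prop :=
  forall phi : nat -> nat, {homo phi : i j / (i < j)%N} -> is_lim S (s_ \o phi) s.

Definition admissible S T D : Prop :=
  forall t, T t -> (exists2 t', T t' & normal_path S t [:: t']) \/ D (dom t).

(* The second clause is the case where a x is invertible, so that it has no
   head: x is then an object, and the role of the head of a x is played by the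
   object t(a), so that D is stable under isomorphism of objects.  For
   invertible a and x in T nothing has to be added: by admissibility H(ax) is
   equal to H((ax)x') for some x' in the union of T and D. *)
Definition H_invariant S T D : Prop :=
  (forall a x, ~ invertible a -> (T `|` D) x -> dom a = tgt x ->
     exists2 h, is_head S (ccomp a x) h & T h) /\
  (forall u x, invertible u -> D x -> dom u = tgt x -> D (tgt u)).

Definition max_closed S T D : Prop :=
  forall (t_ : nat -> C) s, (forall i, T (t_ i)) -> lim_exists S t_ s ->
    (T `|` D) s.

End Category.

Arguments objects : clear implicits.
Arguments left_cancellative : clear implicits.
Arguments finitely_aligned : clear implicits.
Arguments invertible : clear implicits.
Arguments Jmap : clear implicits.
Arguments Omega : clear implicits.

(* Main.v *)
Require Import Defs.
From mathcomp Require Import all_boot all_order all_algebra.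
From mathcomp Require Import all_classical all_reals all_analysis.

(** A character in [Omega] is determined by the set [F] of those [c] for which
    it is true on the principal right ideal [c C].  These sets are the filters
    for left divisibility: non-empty, closed under left divisors, and directed.
    Conversely a filter [F] gives the character that is true on [e] when [e]
    meets [F].  Both passages are inverse to each other because, by finite
    alignment, every constructible ideal is a finite union of principal ones.
    A subspace of [Omega] becomes a set [Y] of filters; it is invariant when
    [Y] is closed under [F |-> a^-1 F] and [F |-> a F], and closed when [Y]
    contains each filter that its members approximate on finite sets.

    The letter of a filter [F] is the largest element of [S] in [F], or the
    target of [F] if [F] does not meet [S]; it exists because [S] is closed
    under right comultiples and locally bounded.  The letters of the filters in
    [Y] form the union of a set [T] of elements of [S] and a set [D] of
    objects, and the correspondence sends [Y] to [(T, D)].  Its inverse sends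
    [(T, D)] to the set of the filters [F] such that, for every [a] in [F], the
    letter of [a^-1 F] is in [T] or [D].

    Everything rests on the identity [H(a b) = H(a H(b))], in the following form
    ([lshift_letter]): an element of [S] lies in [a F] only if it divides [a x],
    where [x] is the letter of [F].  It is proved by induction on [a], which
    ranges over products of elements of [S] and invertible elements.
    - The pair recovers [Y] ([filters_spelled_letters]).  Let all the letters of
      [F] be letters of filters in [Y], and let [A] be finite.  For [a] far
      enough in [F] and [G] in [Y] with the same letter as [a^-1 F], the filters
      [a G] and [F] agree on [A] ([far_letter_notin]), so [F] is in [Y].
    - The pair satisfies the three conditions.  For closure under limits, take
      filters [F_i] in [Y] whose letters [t_i] have the limit [s]; let [F] be
      the limit of the [F_i] along an ultrafilter.  The letter of [F] divides
      [t_i] along a subsequence, hence equals [s].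
    - Every pair [(T, D)] that satisfies the conditions arises.  Invariance of
      the set of filters comes from [H]-invariance.  For its closedness, let a
      sequence of filters in it converge to [F]; such a sequence exists as [C] is
      countable.  The letters after [a] of these filters are infinitely often in
      [T], and then have the letter of [a^-1 F] as limit along a subsequence, or
      they are almost all equal to the object [dom a], which is then the letter
      of [a^-1 F] ([filters_spelled_closed]).
      Every [x] in [T] or [D] is a letter: admissibility prolongs [x] to an
      infinite normal path, constant once an object is reached, and the left
      divisors of its finite products form a filter with letter [x]
      ([path_filter_spelled]). *)

Set Implicit Arguments.
Unset Strict Implicit.
Unset Printing Implicit Defensive.

Local Open Scope classical_set_scope.

(** * Finite intersections and subsequences *)

Lemma filter_finite_bigcap (T J : Type) (Fl : set_system T) (D : set J)
    (f : J -> set T) :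
  Filter Fl -> finite_set D -> (forall j, D j -> Fl (f j)) ->
  Fl (\bigcap_(j in D) f j).
Proof.
move=> FlF /(@finite_fsetP {classic J}) [X ->] Xf.
by apply: (@filter_bigI T {classic J}).
Qed.

Lemma frequently_subsequence (P : nat -> Prop) :
  (forall N, exists i, (N < i)%N /\ P i) ->
  exists phi : nat -> nat,
    {homo phi : i j / (i < j)%N} /\ forall n, P (phi n).
Proof.
move=> freq; have [next nextP] := choice freq.
exists (fun n => iter n.+1 next 0%N); split; last by move=> n; exact: (nextP _).2.
by apply: homo_ltn => [i j k /ltn_trans|i]; [apply|exact: (nextP _).1].
Qed.

Lemma increasing_ge (phi : nat -> nat) : {homo phi : i j / (i < j)%N} ->
  forall n, (n <= phi n)%N.
Proof.
by move=> phi_incr; elim=> // n IHn; apply: leq_ltn_trans IHn (phi_incr _ _ _).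
Qed.

(** * Closed sets for pointwise convergence *)

Section PointwiseTopology.
Variable I : Type.
Implicit Types (chi psi : {ptws I -> bool}) (E : set I).

(** The maps that agree with [chi] on [E]. *)
Definition agree E chi : set {ptws I -> bool} :=
  [set psi | forall i, E i -> psi i = chi i].

Lemma nbhs_eval chi i : nbhs chi [set psi | psi i = chi i].
Proof.
have /cvg_sup/(_ i) cvg_i : nbhs chi --> chi by exact: cvg_id.
apply: cvg_i; rewrite /=.
have := @initial_continuous _ _ (fun f : I -> bool => f i) chi.
move=> /(_ [set chi i]); apply.
by rewrite nbhs_principalE.
Qed.

Lemma nbhs_agree chi E : finite_set E -> nbhs chi (agree E chi).
Proof.
move=> finE; apply: (@filter_finite_bigcap _ _ _ _ (fun i => [set psi | psi i = chi i])).
  by [].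
by move=> i _; exact: nbhs_eval.
Qed.

Lemma nbhs_agreeP chi (W : set {ptws I -> bool}) :
  nbhs chi W -> exists2 E, finite_set E & agree E chi `<=` W.
Proof.
pose Fl : set_system {ptws I -> bool} :=
  filter_from (@finite_set I) (fun E => agree E chi).
have FlF : Filter Fl.
  apply: filter_from_filter; first by exists set0; exact: finite_set0.
  move=> E1 E2 fin1 fin2; exists (E1 `|` E2); first by rewrite finite_setU.
  by move=> psi h; split=> i Ei; apply: h; [left|right].
(* Fl converges to chi coordinate by coordinate, hence contains W. *)
suff : Fl --> chi by move=> /(_ W) h /h [E fE sE]; exists E.
apply/cvg_sup => i V.
rewrite (@nbhsE (initial_topology (fun f : I -> bool => f i))).
move=> -[B [[U oU <-] Uchi] sBV].
exists [set i]; first exact: finite_set1.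
by move=> psi h; apply: sBV; rewrite /= h.
Qed.

(** A set of maps to a discrete space is closed in a subspace [Z] when it
    contains each point of [Z] that it approximates on finite sets of
    coordinates. *)
Lemma closed_subspace_ptwsP (X Z : set {ptws I -> bool}) : X `<=` Z ->
  closed (X : set (subspace Z)) <->
  forall chi, Z chi ->
    (forall E, finite_set E -> exists2 psi, X psi & agree E chi psi) -> X chi.
Proof.
move=> XZ; split=> [/closed_subspaceP [V clV VX] chi Zchi apx|Xcl].
  suff [] : (X `&` Z) chi by [].
  rewrite -VX; split=> //; apply: clV => W /nbhs_agreeP [E finE EW].
  have [psi Xpsi /EW Wpsi] := apx _ finE; exists psi; split=> //.
  by have [] : (V `&` Z) psi by rewrite VX; split=> //; exact: XZ.
apply/closed_subspaceP; exists (closure X); first exact: closed_closure.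
rewrite predeqE => chi; split=> -[chiX Zchi]; split=> //.
  apply: Xcl => // E finE.
  by have [psi [? ?]] := chiX _ (nbhs_agree chi finE); exists psi.
exact: subset_closure.
Qed.

End PointwiseTopology.

(** * Left divisibility *)

Local Notation "a *c b" := (ccomp a b) (at level 40, left associativity).
Local Notation "a <=| b" := (ldivides a b) (at level 70, no associativity).

Section Divisibility.
Variable C : category.
Implicit Types a b c s x y z : C.

Lemma ldividesP a b : a <=| b <-> exists2 s, dom a = tgt s & b = a *c s.
Proof.
by split=> [[s [_ ? ?]]|[s ? ?]]; exists s.
Qed.

Lemma ldivides_refl a : a <=| a.
Proof. by apply/ldividesP; exists (dom a); rewrite ?tgt_dom ?ccompc1. Qed.

Lemma ldivides_compl a b : dom a = tgt b -> a <=| a *c b.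
Proof. by move=> ab; apply/ldividesP; exists b. Qed.

Lemma ldivides_trans b a c : a <=| b -> b <=| c -> a <=| c.
Proof.
move=> /ldividesP [s as_ ->] /ldividesP [t].
rewrite dom_ccomp // => st ->.
by rewrite -ccompA //; apply: ldivides_compl; rewrite tgt_ccomp.
Qed.

Lemma ldivides_tgt a b : a <=| b -> tgt a = tgt b.
Proof. by move=> /ldividesP [s as_ ->]; rewrite tgt_ccomp. Qed.

Lemma tgt_ldivides a : tgt a <=| a.
Proof. by apply/ldividesP; exists a; rewrite ?dom_tgt ?ccomp1c. Qed.

Lemma ldivides_comp2l a x y :
  dom a = tgt x -> x <=| y -> a *c x <=| a *c y.
Proof.
move=> ax /ldividesP [s xs ->]; rewrite ccompA //.
by apply: ldivides_compl; rewrite dom_ccomp.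
Qed.

Lemma object_tgt v : objects C v -> tgt v = v.
Proof. by rewrite /objects /= => <-; rewrite tgt_dom. Qed.

Lemma objects_dom a : objects C (dom a).
Proof. by rewrite /objects /= dom_dom. Qed.

Lemma objects_tgt a : objects C (tgt a).
Proof. by rewrite /objects /= dom_tgt. Qed.

Hypothesis LC : left_cancellative C.

Lemma ldivides_cancel a x y : dom a = tgt x -> dom a = tgt y ->
  a *c x <=| a *c y -> x <=| y.
Proof.
move=> ax ay /ldividesP [s]; rewrite dom_ccomp // => xs e.
apply/ldividesP; exists s => //; apply: (LC (c := a)) => //; last by rewrite e ccompA.
by rewrite tgt_ccomp.
Qed.

Lemma invertibleE a : invertible C a <-> a <=| tgt a.
Proof.
split=> [[b [ab _ e _]]|/ldividesP [s as_ e]].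
  by rewrite -e; apply: ldivides_compl.
have sa : dom s = tgt a by rewrite -(dom_ccomp as_) -e dom_tgt.
exists s; split=> //; apply: (LC (c := a)); rewrite ?tgt_ccomp ?tgt_dom //.
by rewrite ccompA // -e ccomp1c ccompc1.
Qed.

Lemma invertible_ldivides a b : a <=| b -> invertible C b -> invertible C a.
Proof.
move=> ab /invertibleE bt; apply/invertibleE.
by rewrite (ldivides_tgt ab); exact: ldivides_trans ab bt.
Qed.

Lemma object_invertible v : objects C v -> invertible C v.
Proof.
by move=> /object_tgt vE; apply/invertibleE; rewrite vE; exact: ldivides_refl.
Qed.

Lemma ldivides_inv a e : dom a = tgt e -> invertible C e -> a *c e <=| a.
Proof.
move=> ae /invertibleE /(ldivides_comp2l ae).
by rewrite -ae ccompc1.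
Qed.

Lemma ldivides_anti a b : a <=| b -> b <=| a -> eqstar a b.
Proof.
move=> /ldividesP [t at_ be] ba; move/ldividesP: (ba) => [s bs ae].
exists s; split=> //; apply/invertibleE; rewrite -bs.
apply: (ldivides_cancel (a := b)); rewrite ?tgt_dom //.
by rewrite -ae ccompc1 be; exact: ldivides_compl.
Qed.

Lemma invertible_comp a b : dom a = tgt b ->
  invertible C a -> invertible C b -> invertible C (a *c b).
Proof.
move=> ab ia ib; apply/invertibleE; rewrite tgt_ccomp //.
by apply: ldivides_trans (ldivides_inv ab ib) _; exact/invertibleE.
Qed.

Lemma invertible_compr a b : dom a = tgt b ->
  invertible C (a *c b) -> invertible C b.
Proof.
move=> ab /invertibleE; rewrite tgt_ccomp // => abt; apply/invertibleE.
apply: (ldivides_cancel (a := a)); rewrite ?tgt_tgt // -ab ccompc1.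
exact: ldivides_trans abt (tgt_ldivides a).
Qed.

(** * Filters for left divisibility *)

(** Non-empty sets that are closed under left divisors and directed for left
    divisibility. *)
Definition division_filter (F : set C) : Prop :=
  [/\ F !=set0, forall a b, a <=| b -> F b -> F a &
      forall a b, F a -> F b -> exists c, [/\ F c, a <=| c & b <=| c]].

(** The quotient [a^-1 F]; it is a filter when [F a]. *)
Definition ldquot a (F : set C) : set C := [set z | dom a = tgt z /\ F (a *c z)].

(** The product [a F]: the left divisors of the [a z] with [z] in [F].  It is a
    filter when [F (dom a)], that is, when the elements of [F] have target
    [dom a]. *)
Definition lshift a (F : set C) : set C :=
  [set y | exists z, [/\ F z, dom a = tgt z & y <=| a *c z]].

Implicit Type F : set C.

Lemma dfilter_down F a b : division_filter F -> a <=| b -> F b -> F a.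
Proof. by case=> _ h _; exact: h. Qed.

Lemma dfilter_ub F a b : division_filter F -> F a -> F b ->
  exists c, [/\ F c, a <=| c & b <=| c].
Proof. by case=> _ _; exact. Qed.

Lemma dfilter_tgt F a b : division_filter F -> F a -> F b -> tgt a = tgt b.
Proof.
by move=> dF Fa /(dfilter_ub dF Fa) [c [_ /ldivides_tgt -> /ldivides_tgt ->]].
Qed.

Lemma dfilter_F_tgt F a : division_filter F -> F a -> F (tgt a).
Proof. by move=> dF; apply: dfilter_down dF (tgt_ldivides a). Qed.

Lemma dfilter_dom F a z : division_filter F -> F (dom a) -> F z -> dom a = tgt z.
Proof. by move=> dF Fa Fz; rewrite -(dfilter_tgt dF Fa Fz) tgt_dom. Qed.

Lemma ldquot_dom F a : F a -> ldquot a F (dom a).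
Proof. by rewrite /ldquot /= tgt_dom ccompc1. Qed.

Lemma dfilter_ldquot F a : division_filter F -> F a -> division_filter (ldquot a F).
Proof.
move=> dF Fa; split.
- by exists (dom a); exact: ldquot_dom.
- move=> x y xy [ay Fy]; have ax : dom a = tgt x by rewrite (ldivides_tgt xy).
  by split=> //; apply: dfilter_down dF _ Fy; exact: ldivides_comp2l.
- move=> x y [ax Fx] [ay Fy].
  have [c [Fc xc yc]] := dfilter_ub dF Fx Fy.
  have /ldividesP [z az cE] := ldivides_trans (ldivides_compl ax) xc.
  exists z; subst c; split; first by split.
  + exact: ldivides_cancel xc.
  + exact: ldivides_cancel yc.
Qed.

Lemma dfilter_lshift F a : division_filter F -> F (dom a) ->
  division_filter (lshift a F).
Proof.
move=> dF Fa; split.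
- by exists (a *c dom a), (dom a); rewrite tgt_dom; split=> //; exact: ldivides_refl.
- by move=> x y xy [z [Fz az yz]]; exists z; split=> //; exact: ldivides_trans yz.
- move=> x y [z [Fz az xz]] [w [Fw aw yw]].
  have [c [Fc zc wc]] := dfilter_ub dF Fz Fw.
  have ac := dfilter_dom dF Fa Fc.
  exists (a *c c); split; first by exists c; split=> //; exact: ldivides_refl.
  + by apply: ldivides_trans xz _; exact: ldivides_comp2l.
  + by apply: ldivides_trans yw _; exact: ldivides_comp2l.
Qed.

Lemma ldquot_comp F a b : dom a = tgt b ->
  ldquot (a *c b) F = ldquot b (ldquot a F).
Proof.
move=> ab; rewrite predeqE => z; rewrite /ldquot /= dom_ccomp //.
split=> [[bz Fz]|[bz [_ Fz]]]; first by rewrite tgt_ccomp // ccompA.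
by rewrite -ccompA.
Qed.

Lemma ldquot_lshift F a : division_filter F -> F (dom a) ->
  ldquot a (lshift a F) = F.
Proof.
move=> dF Fa; rewrite predeqE => z; split=> [[az [w [Fw aw zw]]]|Fz].
  by apply: dfilter_down dF _ Fw; exact: ldivides_cancel zw.
have az := dfilter_dom dF Fa Fz.
by split=> //; exists z; split=> //; exact: ldivides_refl.
Qed.

Lemma lshift_ldquot F a : division_filter F -> F a -> lshift a (ldquot a F) = F.
Proof.
move=> dF Fa; rewrite predeqE => y; split=> [[z [[_ Fz] az yz]]|Fy].
  exact: dfilter_down yz Fz.
have [c [Fc /ldividesP [z az cE] yc]] := dfilter_ub dF Fa Fy.
by exists z; subst c; split.
Qed.

Lemma lshift_comp F a b : division_filter F -> F (dom b) -> dom a = tgt b ->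
  lshift (a *c b) F = lshift a (lshift b F).
Proof.
move=> dF Fb ab; rewrite predeqE => y; split=> [[z [Fz]]|].
  rewrite dom_ccomp // => bz; rewrite -ccompA // => yz.
  exists (b *c z); rewrite tgt_ccomp //; split=> //.
  by exists z; split=> //; exact: ldivides_refl.
move=> [w [[z [Fz bz wz]] aw yw]]; exists z; rewrite dom_ccomp // -ccompA //.
by split=> //; apply: ldivides_trans yw _; exact: ldivides_comp2l.
Qed.

(** The filter of sets that is generated by the tails of [F]: a property holds
    along [tails F] when it holds for all large enough elements of [F]. *)
Definition tails F : set_system C :=
  filter_from F (fun a => [set b | F b /\ a <=| b]).

Lemma tails_filter F : division_filter F -> ProperFilter (tails F).
Proof.
move=> dF; apply: filter_from_proper.
  apply: filter_from_filter; first by case: dF.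
  move=> a b Fa Fb; have [c [Fc ac bc]] := dfilter_ub dF Fa Fb.
  by exists c => // d [Fd cd]; split; split=> //; apply: ldivides_trans cd.
by move=> a Fa; exists a; split=> //; exact: ldivides_refl.
Qed.

End Divisibility.

(** * Characters in Omega as filters *)

Section CharactersAsFilters.
Variable C : category.
Implicit Types a b c s x y z : C.
Implicit Type F : set C.

Lemma hull_injective (s : partial_map C) : left_cancellative C ->
  left_inverse_hull s ->
  (forall x y y', s x y -> s x y' -> y = y') /\
  (forall x x' y, s x y -> s x' y -> x = x').
Proof.
move=> LC; elim=> [c|{}s _ [h1 h2]|{}s t _ [s1 s2] _ [t1 t2]].
- split=> [x y y' [_ ->] [_ ->] //|x x' y [cx ->] [cx' e]].
  exact: LC e.
- by split=> [x y y'|x x' y]; [exact: h2|exact: h1].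
- split=> [x z z' [y xy yz] [y' xy' yz']|x x' z [y xy yz] [y' xy' yz']].
    by apply: s1 yz _; rewrite (t1 _ _ _ xy xy').
  by apply: t2 xy _; rewrite (s2 _ _ _ yz yz').
Qed.

Lemma rideal_constructible c : is_constructible (rideal c).
Proof.
exists (pm_inv (lmul_map c)); first by apply: hull_inv; exact: hull_lmul.
rewrite predeqE => x; split=> [[s [_ ? ?]]|[s [? ?]]]; by exists s.
Qed.

(** The principal right ideal [c C]. *)
Definition principal c : constructible C := exist _ _ (rideal_constructible c).

(** The partial bijection of [C] that maps [b z] to [a z]. *)
Definition bimap a b : partial_map C :=
  fun x y => exists z, [/\ dom b = tgt z, x = b *c z & y = a *c z].

Hypothesis LC : left_cancellative C.
Hypothesis FA : finitely_aligned C.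

Lemma constructibleI (e f : constructible C) :
  exists g : constructible C, sval g = sval e `&` sval f.
Proof.
case: e => e [s hs def_e]; have [s1 s2] := hull_injective LC hs.
have ht : left_inverse_hull (pm_comp (pm_inv s) s).
  by apply: hull_comp => //; exact: hull_inv.
exists (pullback ht f); rewrite /= def_e predeqE => x; split=> /=.
  move=> [y [z xz yz] fy]; have <- : y = x by exact: s2 yz xz.
  by split=> //; exists z.
by move=> [[z xz] fx]; exists x => //; exists z.
Qed.

(** By finite alignment, the elements of the inverse hull are finite unions of
    maps [bimap a b]: if [a z = b' z'], then this element is in [c C] for one of
    the finitely many [c] that generate the intersection of [a C] and [b' C]. *)
Lemma hull_bimaps (s : partial_map C) : left_inverse_hull s ->
  exists P : set (C * C), [/\ finite_set P,
    forall p, P p -> dom p.1 = dom p.2 &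
    forall x y, s x y <-> exists2 p, P p & bimap p.1 p.2 x y].
Proof.
elim=> [c|{}s _ [P [finP domP sE]]|{}s t _ [Q [finQ domQ sE]] _ [P [finP domP tE]]].
- exists [set (c, dom c)]; split; first exact: finite_set1.
    by move=> _ ->; rewrite /= dom_dom.
  move=> x y; split=> [[cx ->]|[_ -> [z [/= + -> ->]]]].
    by exists (c, dom c) => //; exists x; rewrite /= dom_dom cx ccomp1c.
  by rewrite dom_dom => cz; split; rewrite cz ccomp1c.
- exists ((fun p => (p.2, p.1)) @` P); split; first exact: finite_image.
    by move=> _ [p Pp <-] /=; rewrite (domP _ Pp).
  move=> x y; rewrite [pm_inv s x y]sE; split=> [[p Pp [z [pz -> ->]]]|].
    by exists (p.2, p.1); [exists p|exists z; rewrite /= (domP _ Pp)].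
  move=> [_ [p Pp <-]] [z [/= pz -> ->]].
  by exists p => //; exists z; rewrite -(domP _ Pp).
- have [K KP] := choice (fun ab : C * C => FA ab.1 ab.2).
  (* quot (a, c) is the quotient a^-1 c when a divides c. *)
  have [quot quotP] : exists quot : C * C -> C, forall a c u,
      dom a = tgt u -> c = a *c u -> quot (a, c) = u.
    have [|quot quotP] := @choice (C * C) C (fun ac w => forall u,
      dom ac.1 = tgt u -> ac.2 = ac.1 *c u -> w = u); last first.
      by exists quot => a c u au cu; exact: quotP (a, c) u au cu.
    move=> [a c] /=.
    have [[u au cu]|nu] := pselect (exists2 u, dom a = tgt u & c = a *c u).
      by exists u => v av; rewrite cu; exact: LC.
    by exists a => u au cu; case: nu; exists u.
  pose f (p q : C * C) c := (q.1 *c quot (q.2, c), p.2 *c quot (p.1, c)).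
  have KE p q c : K (p.1, q.2) c -> exists u v,
      [/\ dom p.1 = tgt u, dom q.2 = tgt v, c = p.1 *c u, c = q.2 *c v
        & f p q c = (q.1 *c v, p.2 *c u)].
    move=> Kc; have : (rideal p.1 `&` rideal q.2) c.
      have [_ ->] := KP (p.1, q.2); exists c => //; exact: ldivides_refl.
    move=> [/ldividesP [u pu cu] /ldividesP [v qv cv]]; exists u, v.
    by rewrite /f (quotP _ _ _ pu cu) (quotP _ _ _ qv cv).
  exists (\bigcup_(p in P) \bigcup_(q in Q) f p q @` K (p.1, q.2)); split.
  + apply: bigcup_finite => // p _; apply: bigcup_finite => // q _.
    by apply: finite_image; case: (KP (p.1, q.2)).
  + move=> _ [p Pp [q Qq [c /KE [u [v [pu qv cu cv ->]]] <-]]] /=.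
    rewrite !dom_ccomp -?(domP _ Pp) ?(domQ _ Qq) //.
    by rewrite -(dom_ccomp pu) -(dom_ccomp qv) -cu cv.
  + move=> x z; split.
      move=> [y /tE [p Pp [w [pw -> ->]]] /sE [q Qq [w' [qw' yE ->]]]].
      rewrite -(domP _ Pp) in pw.
      have : (rideal p.1 `&` rideal q.2) (p.1 *c w).
        by split; [|rewrite yE]; exact: ldivides_compl.
      rewrite (KP (p.1, q.2)).2 => -[c Kc /ldividesP [r cr pwE]].
      have [u [v [pu qv cu cv fE]]] := KE _ _ _ Kc.
      have ur : dom u = tgt r by rewrite -(dom_ccomp pu) -cu.
      have vr : dom v = tgt r by rewrite -(dom_ccomp qv) -cv.
      have wE : w = u *c r.
        by apply: LC pw _ _; rewrite ?tgt_ccomp // pwE ccompA // -cu.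
      have w'E : w' = v *c r.
        by apply: LC qw' _ _; rewrite ?tgt_ccomp // -yE pwE ccompA // -cv.
      exists (f p q c); first by exists p => //; exists q => //; exists c.
      exists r; rewrite fE /= dom_ccomp -?(domP _ Pp) // wE w'E !ccompA //.
      * by rewrite (domQ _ Qq).
      * by rewrite -(domP _ Pp).
    move=> [_ [p Pp [q Qq [c Kc <-]]]].
    have [u [v [pu qv cu cv ->]]] := KE _ _ _ Kc.
    have qv1 : dom q.1 = tgt v by rewrite (domQ _ Qq).
    have pu2 : dom p.2 = tgt u by rewrite -(domP _ Pp).
    move=> [r [/=]]; rewrite dom_ccomp // => ur -> ->.
    have vr : dom v = tgt r by rewrite -ur -(dom_ccomp qv) -(dom_ccomp pu) -cu cv.
    exists (p.1 *c (u *c r)).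
      apply/tE; exists p => //; exists (u *c r).
      by rewrite tgt_ccomp // ccompA.
    apply/sE; exists q => //; exists (v *c r).
    by rewrite tgt_ccomp // !ccompA // -cu -cv.
Qed.

Lemma constructible_up (e : constructible C) x y :
  sval e x -> x <=| y -> sval e y.
Proof.
case: e => e [s hs eE] /=; rewrite eE => -[x' sxx'] /ldividesP [t xt ->].
have [P [_ domP sE]] := hull_bimaps hs.
move: sxx' xt => /sE [p Pp [z [pz -> _]]]; rewrite dom_ccomp // => zt.
exists (p.1 *c (z *c t)); apply/sE; exists p => //; exists (z *c t).
by rewrite tgt_ccomp // ccompA.
Qed.

Lemma constructible_finite_union (e : constructible C) :
  exists K : set C, finite_set K /\ sval e = \bigcup_(c in K) rideal c.
Proof.
case: e => e [s hs eE] /=; have [P [finP domP sE]] := hull_bimaps hs.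
exists (snd @` P); split; first exact: finite_image.
rewrite eE predeqE => x; split=> [[y /sE [p Pp [z [pz -> _]]]]|].
  by exists p.2; [exists p|exact: ldivides_compl].
move=> [_ [p Pp <-] /ldividesP [z pz ->]].
by exists (p.1 *c z); apply/sE; exists p => //; exists z.
Qed.

(** The filter of the character [chi], and the character of the filter [F]:
    it is true on the constructible ideals that meet [F]. *)
Definition filt_of (chi : Jmap C) : set C := [set c | chi (principal c)].

Definition char_of F : Jmap C := fun e => `[< F `&` sval e !=set0 >].

Lemma char_ofP F (e : constructible C) :
  char_of F e <-> exists2 x, F x & sval e x.
Proof.
by split=> [/asboolP [x [? ?]]|[x ? ?]]; [exists x|apply/asboolP; exists x].
Qed.

Lemma char_of_principal F c : division_filter F -> char_of F (principal c) <-> F c.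
Proof.
move=> dF; split=> [/char_ofP [x Fx cx]|Fc]; first exact: dfilter_down cx Fx.
by apply/char_ofP; exists c => //; exact: ldivides_refl.
Qed.

Lemma char_ofK F : division_filter F -> filt_of (char_of F) = F.
Proof. by move=> dF; rewrite predeqE => c; exact: char_of_principal. Qed.

Lemma char_of_Omega F : division_filter F -> Omega C (char_of F).
Proof.
move=> dF; split; first split.
- case: (dF) => [[c Fc] _ _]; exists (principal c).
  exact/char_of_principal.
- move=> e f g gE; apply/idP/andP => [|[]].
    by move=> /char_ofP [x Fx]; rewrite gE => -[? ?]; split; apply/char_ofP; exists x.
  move=> /char_ofP [x Fx ex] /char_ofP [y Fy fy].
  have [z [Fz xz yz]] := dfilter_ub dF Fx Fy.
  apply/char_ofP; exists z => //; rewrite gE.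
  by split; [exact: constructible_up xz|exact: constructible_up yz].
- move=> e e0; apply/negP => /char_ofP [x _]; by rewrite e0.
- move=> n e f eE /char_ofP [x Fx]; rewrite eE => -[i _ fx].
  by exists i; apply/char_ofP; exists x.
Qed.

Lemma Omega_finite_union (chi : Jmap C) e (K : set C) : Omega C chi ->
  finite_set K -> sval e = \bigcup_(c in K) rideal c -> chi e ->
  exists2 c, K c & chi (principal c).
Proof.
move=> [[_ _ chi0] chiU] /(@finite_seqP {classic C}) [[|x s] ->] eE che.
  by move: che; rewrite chi0 // eE set_nil bigcup_set0.
have [|i chi_i] := chiU (size s) e (fun i => principal (nth x (x :: s) i)) _ che.
  rewrite eE predeqE => y; split=> [[c /= cs cy]|[i _ iy]].
    have ci : (index (c : {classic C}) (x :: s) < (size s).+1)%N by rewrite index_mem.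
    by exists (Ordinal ci) => //=; rewrite -/(nth x (x :: s) _) nth_index.
  by exists (nth x (x :: s) i) => //=; exact: (@mem_nth {classic C}).
exists (nth x (x :: s) i) => //=; exact: (@mem_nth {classic C}).
Qed.

Lemma Omega_principal (chi : Jmap C) (e : constructible C) c : Omega C chi ->
  chi (principal c) -> sval e c -> chi e.
Proof.
move=> [[_ mul _] _] chic ec.
have : chi (principal c) = chi (principal c) && chi e.
  apply: mul; apply/esym/setIidl => x; exact: constructible_up.
by rewrite chic.
Qed.

Lemma filt_of_dfilter (chi : Jmap C) : Omega C chi -> division_filter (filt_of chi).
Proof.
move=> Och; have [[[e che] mul _] _] := Och; split.
- have [K [finK eK]] := constructible_finite_union e.
  by have [c _ chic] := Omega_finite_union Och finK eK che; exists c.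
- move=> a b ab chib; exact: (Omega_principal (e := principal a) Och chib ab).
- move=> a b chia chib; have [g gE] := constructibleI (principal a) (principal b).
  have [K [finK KE]] := FA a b.
  have [||c Kc chic] := @Omega_finite_union chi g K Och finK; first by rewrite gE.
    by rewrite (mul _ _ _ gE) chia chib.
  exists c; have [] : (rideal a `&` rideal b) c; last by [].
  by rewrite KE; exists c => //; exact: ldivides_refl.
Qed.

Lemma filt_ofK (chi : Jmap C) : Omega C chi -> char_of (filt_of chi) = chi.
Proof.
move=> Och; apply/funext => e; apply/idP/idP.
  by move=> /char_ofP [x chix ex]; exact: Omega_principal Och chix ex.
move=> che; have [K [finK eK]] := constructible_finite_union e.
have [c Kc chic] := Omega_finite_union Och finK eK che.
apply/char_ofP; exists c => //; rewrite eK; exists c => //; exact: ldivides_refl.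
Qed.

End CharactersAsFilters.

(** * Closed invariant subspaces as sets of filters *)

Section ClosedInvariantFamilies.
Variable C : category.
Hypothesis LC : left_cancellative C.
Hypothesis FA : finitely_aligned C.
Implicit Types a b c s x y z : C.
Implicit Types (F G : set C) (X : set (Jmap C)) (Y : set (set C)).

(** Closedness: [Y] contains the filters that its members approximate on
    finite sets. *)
Definition fclosed Y : Prop :=
  forall F, division_filter F ->
    (forall A, finite_set A -> exists2 G, Y G & forall c, A c -> G c <-> F c) ->
    Y F.

(** Invariance.  The maps [c z |-> z] and [z |-> c z] suffice, since they
    generate the inverse hull. *)
Definition finvariant Y : Prop :=
  (forall F a, Y F -> F a -> Y (ldquot a F)) /\
  (forall F a, Y F -> F (dom a) -> Y (lshift a F)).

(** The sets of filters that correspond to closed invariant subspaces. *)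
Definition closed_invariant_family Y : Prop :=
  [/\ Y `<=` @division_filter C, fclosed Y & finvariant Y].

(** The filters whose characters are in [X]. *)
Definition filters_of X : set (set C) :=
  [set F | division_filter F /\ X (char_of F)].

Lemma ldquot_object F v : division_filter F -> objects C v -> F v -> ldquot v F = F.
Proof.
move=> dF vv Fv; have vF z : F z -> dom v = tgt z.
  by move=> Fz; rewrite -(dfilter_tgt dF Fv Fz) vv object_tgt.
rewrite predeqE => z; split=> [[vz]|Fz].
  by rewrite -[X in X *c z]vv vz ccomp1c.
by split; [exact: vF|rewrite -[X in X *c z]vv (vF _ Fz) ccomp1c].
Qed.

Lemma lshift_object F v : division_filter F -> objects C v -> F v -> lshift v F = F.
Proof.
move=> dF vv Fv; rewrite -{1}(ldquot_object dF vv Fv); exact: lshift_ldquot.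
Qed.

Lemma hull_equivariant (s : partial_map C) x y t : left_inverse_hull s ->
  s x y -> dom x = tgt t -> s (x *c t) (y *c t).
Proof.
move=> hs; have [P [_ domP sE]] := hull_bimaps LC FA hs.
move=> /sE [p Pp [z [pz -> ->]]]; rewrite dom_ccomp // => zt.
apply/sE; exists p => //; exists (z *c t); rewrite tgt_ccomp // !ccompA //.
by rewrite domP.
Qed.

(** An element of the inverse hull that restricts to [bimap a b], with [b] in
    [F], maps [F] to [a (b^-1 F)]. *)
Lemma act_char_of (s : partial_map C) (hs : left_inverse_hull s) F a b :
  division_filter F -> dom a = dom b -> (forall x y, bimap a b x y -> s x y) ->
  F b -> act hs (char_of F) = char_of (lshift a (ldquot b F)).
Proof.
move=> dF ab abs Fb; apply/funext => e; apply/idP/idP.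
  move=> /(char_ofP F) [x Fx [y sxy ey]].
  have [w [Fw /ldividesP [z bz wE] /ldividesP [t xt wE']]] := dfilter_ub dF Fb Fx.
  have yE : y *c t = a *c z.
    have [s1 _] := hull_injective LC hs; apply: (s1 w).
      by rewrite wE'; exact: hull_equivariant.
    by apply: abs; exists z.
  have yt : dom y = tgt t.
    have [P [_ domP sE]] := hull_bimaps LC FA hs.
    move: sxy xt => /sE [p Pp [r [pr -> ->]]].
    by rewrite !dom_ccomp // domP.
  apply/char_ofP; exists (a *c z).
    exists z; rewrite ab; split=> //; last exact: ldivides_refl.
    by split=> //; rewrite -wE.
  by rewrite -yE; apply: constructible_up ey _ => //; exact: ldivides_compl.
move=> /char_ofP [y [z [[bz Fz] az yz]] ey].
apply/(char_ofP F); exists (b *c z) => //; exists (a *c z).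
  by apply: abs; exists z.
exact: constructible_up ey yz.
Qed.

Lemma filters_of_family X :
  closed_invariant X -> closed_invariant_family (filters_of X).
Proof.
move=> [XO Xcl Xinv]; split; first by move=> F [].
- move=> F dF apx; split=> //.
  (* Agreement on the generators of the ideals in E implies agreement on E. *)
  move/(closed_subspace_ptwsP XO): Xcl; apply; first exact: char_of_Omega.
  move=> E finE; have [K KP] := choice (constructible_finite_union LC FA).
  have [|G [dG XG] GF] := apx (\bigcup_(e in E) K e).
    by apply: bigcup_finite => // e _; case: (KP e).
  exists (char_of G) => // e Ee; apply/idP/idP; move=> /char_ofP [x].
    move=> Gx; rewrite (KP e).2 => -[c Kc cx]; apply/char_ofP; exists c.
      by apply/GF; [exists e|exact: dfilter_down cx Gx].
    by rewrite (KP e).2; exists c => //; exact: ldivides_refl.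
  move=> Fx; rewrite (KP e).2 => -[c Kc cx]; apply/char_ofP; exists c.
    by apply/GF; [exists e|exact: dfilter_down cx Fx].
  by rewrite (KP e).2; exists c => //; exact: ldivides_refl.
- have mainX (s : partial_map C) (hs : left_inverse_hull s) F a b :
      division_filter F -> X (char_of F) -> dom a = dom b -> F b ->
      (forall x y, bimap a b x y -> s x y) ->
      filters_of X (lshift a (ldquot b F)).
    move=> dF XF ab Fb abs; split.
      apply: dfilter_lshift; first exact: dfilter_ldquot.
      by rewrite ab; exact: ldquot_dom.
    rewrite -(act_char_of hs) //.
    have es : is_constructible (pm_dom s) by exists s.
    apply: (Xinv _ _ _ (exist _ _ es)) => //.
    apply/char_ofP; exists b => //=; exists a; apply: abs.
    by exists (dom b); rewrite tgt_dom ccompc1 -ab ccompc1.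
  split=> F a [dF XF] Fa.
    rewrite -(@lshift_object (ldquot a F) (dom a)) //.
    + apply: (mainX _ (hull_inv (hull_lmul a))); rewrite ?dom_dom //.
      move=> x y [z [az -> ->]]; split=> //=; rewrite az ccomp1c //.
    + exact: dfilter_ldquot.
    + exact: objects_dom.
    + exact: ldquot_dom.
  rewrite -[F in lshift a F](@ldquot_object F (dom a)) //; last exact: objects_dom.
  apply: (mainX _ (hull_lmul a)); rewrite ?dom_dom //.
  by move=> x y [z [+ -> ->]]; rewrite dom_dom => az; split; rewrite az ccomp1c.
Qed.

Lemma family_closed_invariant Y : closed_invariant_family Y ->
  closed_invariant (@char_of C @` Y).
Proof.
move=> [Yd Ycl [Yq Ys]].
have YO : @char_of C @` Y `<=` Omega C.
  by move=> _ [F YF <-]; apply: char_of_Omega => //; exact: Yd.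
split=> //.
- apply/(closed_subspace_ptwsP YO) => chi Och apx.
  exists (filt_of chi); last exact: filt_ofK.
  have dchi := filt_of_dfilter LC FA Och.
  apply: Ycl => // A finA.
  have [|_ [G YG <-] Gchi] := apx (@principal C @` A); first exact: finite_image.
  exists G => // c Ac; rewrite -(char_of_principal _ (Yd _ YG)).
  by rewrite /filt_of /= Gchi //; exists c.
- move=> s hs _ e [F YF <-] eE /char_ofP [x Fx]; rewrite eE => -[y].
  have [P [_ domP sE]] := hull_bimaps LC FA hs.
  move=> /sE [p Pp [z [pz xE _]]].
  have Fp : F p.2.
    apply: dfilter_down (Yd _ YF) _ Fx; rewrite xE; exact: ldivides_compl.
  exists (lshift p.1 (ldquot p.2 F)).
    by apply: Ys; [exact: Yq|rewrite domP //; exact: ldquot_dom].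
  rewrite (@act_char_of s hs F p.1 p.2) ?domP //; first exact: Yd.
  by move=> u v uv; apply/sE; exists p.
Qed.

Lemma filters_ofK Y : Y `<=` @division_filter C -> filters_of (@char_of C @` Y) = Y.
Proof.
move=> Yd; rewrite predeqE => F; split=> [[dF [G YG e]]|YF].
  by rewrite -(char_ofK dF) -e (char_ofK (Yd _ YG)).
by split; [exact: Yd|exists F].
Qed.

Lemma char_of_filters X : X `<=` Omega C -> @char_of C @` filters_of X = X.
Proof.
move=> XO; rewrite predeqE => chi; split=> [[F [_ XF] <-] //|Xchi].
have Och := XO _ Xchi.
exists (filt_of chi); last exact: filt_ofK.
by split; [exact: filt_of_dfilter|rewrite filt_ofK].
Qed.

End ClosedInvariantFamilies.

(** * Letters of filters *)

Section Letters.
Variables (C : category) (S : set C).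
Hypothesis LC : left_cancellative C.
Hypothesis S_garside : garside S.
Hypothesis S_noninvertible : S `&` invertible C = set0.
Hypothesis S_transverse : transverse S.
Hypothesis S_locally_bounded : locally_bounded S.
Implicit Types a b c r s t x y z : C.
Implicit Types F G : set C.

Lemma garside_ninv s a : S s -> s <=| a -> ~ invertible C a.
Proof.
move=> Ss sa /(invertible_ldivides LC sa) is_.
by have : (S `&` invertible C) s by []; rewrite S_noninvertible.
Qed.

Lemma generates_ind (P : C -> Prop) :
  (forall s, S s -> P s) -> (forall u, invertible C u -> P u) ->
  (forall a b, P a -> P b -> dom a = tgt b -> P (a *c b)) -> forall a, P a.
Proof.
move=> PS Pinv Pcomp a; have [_ gen _ _] := S_garside.
suff PT : [set c | P c] = setT by have : [set: C] a by []; rewrite -PT.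
by apply: gen => // s [/PS|/Pinv].
Qed.

(** Up to an invertible right factor, an element of the sharp closure of [S] is
    in [S] or invertible. *)
Lemma sharpP w : sharp S w ->
  invertible C w \/ exists s, [/\ S s, s <=| w & w <=| s].
Proof.
case=> [[s [Ss [e [ie se ->]]]]|]; [right|by left].
by exists s; split=> //; [exact: ldivides_compl|exact: ldivides_inv].
Qed.

Lemma S_sharp s : S s -> sharp S s.
Proof.
move=> Ss; left; exists s; split=> //; exists (dom s).
rewrite tgt_dom ccompc1; split=> //.
by apply: object_invertible => //; exact: objects_dom.
Qed.

Lemma sharp_right_divisor s x w : S s -> dom x = tgt w -> s = x *c w ->
  sharp S w.
Proof.
move=> Ss xw sE; have [_ _ crd _] := S_garside.
by apply: (crd w s); [exact: S_sharp|exists x].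
Qed.

(** Hence the letter of a filter with a non-invertible element is in [S]. *)
Lemma invertible_or_S_ldivides c : invertible C c \/ exists2 s, S s & s <=| c.
Proof.
elim/generates_ind: c => [s Ss|u iu|a b IHa IHb ab].
- by right; exists s => //; exact: ldivides_refl.
- by left.
- have [ia|[s Ss sa]] := IHa; last first.
    by right; exists s => //; apply: ldivides_trans sa _; exact: ldivides_compl.
  have [ib|[s Ss sb]] := IHb; first by left; exact: invertible_comp.
  have as_ : dom a = tgt s by rewrite (ldivides_tgt sb).
  have [a' [aa' a'a _ a'aE]] := ia.
  have [|ias|[t [St tas ast]]] := @sharpP (a *c s).
  + apply: (@sharp_right_divisor s a') => //; first by rewrite tgt_ccomp.
    by rewrite ccompA // a'aE as_ ccomp1c.
  + by case: (garside_ninv Ss (ldivides_refl s)); exact: invertible_compr ias.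
  + right; exists t => //; apply: ldivides_trans tas _; exact: ldivides_comp2l.
Qed.

(** The letter of a filter [F] is the largest element of [S] in [F], or the
    target of [F] when [F] does not meet [S].  In the second case [x] is an
    object, and the last condition says that [F] does not meet [S], since the
    elements of [S] are not invertible ([letter_object]). *)
Definition letter F x : Prop :=
  [/\ F x, (S `|` objects C) x & forall r, S r -> F r -> r <=| x].

Lemma letter_object F x r : letter F x -> objects C x -> S r -> ~ F r.
Proof.
move=> [_ _ h] ox Sr /(h _ Sr) rx.
by apply: (garside_ninv Sr rx); exact: object_invertible.
Qed.

Lemma S_not_object x : S x -> ~ objects C x.
Proof.
by move=> Sx /(object_invertible LC); apply: garside_ninv Sx _; exact: ldivides_refl.
Qed.

Lemma letter_unique F x y : division_filter F -> letter F x -> letter F y -> x = y.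
Proof.
move=> dF lx ly; have [Fx Dx hx] := lx; have [Fy Dy hy] := ly.
case: Dx Dy => [Sx|ox] [Sy|oy].
- by apply: S_transverse => //; apply: ldivides_anti => //; [exact: hy|exact: hx].
- by case: (letter_object ly oy Sx).
- by case: (letter_object lx ox Sy).
- by rewrite -(object_tgt ox) -(object_tgt oy); exact: dfilter_tgt Fx Fy.
Qed.

Lemma letter_exists F : division_filter F -> exists x, letter F x.
Proof.
move=> dF; apply: contrapT => noletter.
have step s : exists t, S s /\ F s -> [/\ S t, F t & sldivides s t].
  have [[Ss Fs]|] := pselect (S s /\ F s); last by exists s.
  have [t [St Ft ts]] : exists t, [/\ S t, F t & ~ t <=| s].
    apply: contrapT => not; apply: noletter; exists s; split=> //; first by left.
    by move=> r Sr Fr; apply: contrapT => nrs; apply: not; exists r.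
  have [c [Fc sc tc]] := dfilter_ub dF Fs Ft.
  have [crc _ _ _] := S_garside; have [u [Su su tu uc]] := crc _ _ _ Ss St sc tc.
  exists u => _; split=> //; first exact: dfilter_down uc Fc.
  split; first by move=> y uy; exact: ldivides_trans uy.
  move=> /(_ s (ldivides_refl s)) us; apply: ts; exact: ldivides_trans us.
(* Without a letter, F contains an infinite increasing sequence in S. *)
have [next nextP] := choice step.
have [s0 [Ss0 Fs0]] : exists s, S s /\ F s.
  apply: contrapT => not; apply: noletter; have [[c Fc] _ _] := dF.
  exists (tgt c); split; [exact: dfilter_F_tgt|right; exact: objects_tgt|].
  by move=> r Sr Fr; case: not; exists r.
have SFn n : S (iter n next s0) /\ F (iter n next s0).
  by elim: n => // n /nextP [].
apply: (S_locally_bounded (objects_tgt s0)); exists (fun n => iter n next s0) => n.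
have [Sn Fn] := SFn n; split; last by have [] := nextP _ (SFn n).
have tE : tgt s0 = tgt (iter n next s0) := dfilter_tgt dF Fs0 Fn.
by exists (iter n next s0); rewrite dom_tgt tE ccomp1c.
Qed.

Lemma letter_dom F x r : letter F x -> F r -> S r -> S x.
Proof. by move=> lx Fr Sr; case: (lx) => _ [//|/(letter_object lx)/(_ Sr)]. Qed.

Lemma sharp_ldivides_letter F x w : division_filter F -> letter F x ->
  sharp S w -> F w -> w <=| x.
Proof.
move=> dF [Fx _ hx] /sharpP [iw|[s [Ss sw ws]]] Fw.
  apply: (ldivides_trans (b := tgt w)); first exact/invertibleE.
  by rewrite (dfilter_tgt dF Fw Fx); exact: tgt_ldivides.
by apply: ldivides_trans ws _; apply: hx => //; exact: dfilter_down sw Fw.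
Qed.

(** An element of [S] divides [a F] only if it divides [a x], where [x] is the
    letter of [F]: in terms of heads, [H(a b) = H(a H(b))]. *)
Lemma lshift_letter a F x r : division_filter F -> letter F x -> F (dom a) ->
  S r -> lshift a F r -> r <=| a *c x.
Proof.
elim/generates_ind: a F x r => [a Sa|a ia|a b IHa IHb ab] F x r dF lx Fa Sr;
  move=> [z [Fz az rz]]; have [Fx Dx hx] := lx; have ax := dfilter_dom dF Fa Fx.
- have [crc _ _ _] := S_garside.
  have [t [St rt at_ taz]] := crc _ _ _ Sr Sa rz (ldivides_compl az).
  apply: ldivides_trans rt _; move: at_ taz St => /ldividesP [w aw ->] waz Saw.
  apply: ldivides_comp2l => //.
  apply: sharp_ldivides_letter lx _ _ => //.
    exact: sharp_right_divisor Saw aw _.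
  by apply: dfilter_down dF _ Fz; exact: ldivides_cancel waz.
- have [a' [aa' a'a aa'E a'aE]] := ia.
  have ar : tgt a = tgt r by rewrite (ldivides_tgt rz) tgt_ccomp.
  have a'r : dom a' = tgt r by rewrite a'a.
  have aw : dom a = tgt (a' *c r) by rewrite tgt_ccomp.
  have rE : r = a *c (a' *c r) by rewrite ccompA // aa'E ar ccomp1c.
  rewrite rE; apply: ldivides_comp2l => //.
  apply: sharp_ldivides_letter lx _ _ => //; first exact: sharp_right_divisor Sr aw _.
  apply: dfilter_down dF _ Fz; apply: (ldivides_cancel LC) az _ => //.
  by rewrite -rE.
- (* The letter x1 of b F divides b x. *)
  rewrite dom_ccomp // in Fa ax az.
  have dF1 : division_filter (lshift b F) by exact: dfilter_lshift.
  have [x1 lx1] := letter_exists dF1; have [Fx1 Dx1 _] := lx1.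
  have F1a : lshift b F (dom a).
    exists (dom b); rewrite tgt_dom ccompc1; split=> //.
    by rewrite ab; exact: tgt_ldivides.
  have ax1 : dom a = tgt x1 := dfilter_dom dF1 F1a Fx1.
  rewrite -ccompA //; apply: (ldivides_trans (b := a *c x1)).
    apply: IHa lx1 _ _ _ => //.
    exists (b *c z); rewrite tgt_ccomp // ccompA //; split=> //.
    by exists z; split=> //; exact: ldivides_refl.
  apply: ldivides_comp2l => //; case: Dx1 => [Sx1|/object_tgt ox1].
    exact: IHb lx _ _ _.
  by rewrite -ox1 -ax1 ab -(tgt_ccomp ax); exact: tgt_ldivides.
Qed.

(** If a filter [G] contains an element [a] of [F] that is large enough with
    respect to [c], and if [F] and [G] have the same letter after [a], then
    [G] contains [c] only if [F] does. *)
Lemma far_letter_notin F c : division_filter F -> ~ F c ->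
  exists2 a0, F a0 & forall a G x, F a -> a0 <=| a -> division_filter G -> G a ->
    letter (ldquot a F) x -> letter (ldquot a G) x -> ~ G c.
Proof.
elim/generates_ind: c F => [c Sc|c ic|c d IHc IHd cd] F dF nFc.
- have [[a0 Fa0] _ _] := dF; exists a0 => // a G x Fa _ dG Ga lF lG Gc; apply: nFc.
  have [[ax Fx] _ _] := lF; apply: dfilter_down dF _ Fx.
  apply: (lshift_letter _ lG) => //; first exact: dfilter_ldquot.
    exact: ldquot_dom.
  by rewrite lshift_ldquot.
- have [[a0 Fa0] _ _] := dF; exists a0 => // a G x Fa _ dG Ga _ _ Gc; apply: nFc.
  have ct : c <=| tgt c by exact/invertibleE.
  apply: (dfilter_down dF ct); rewrite (dfilter_tgt dG Gc Ga).
  exact: dfilter_F_tgt dF Fa.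
- have [Fc|nFc1] := pselect (F c); last first.
    have [a0 Fa0 h] := IHc _ dF nFc1; exists a0 => // a G x Fa a0a dG Ga lF lG Gcd.
    apply: (h a G x) => //; apply: dfilter_down dG _ Gcd; exact: ldivides_compl.
  have [|a0 [ca0 Fa0] h] := IHd (ldquot c F) (dfilter_ldquot LC dF Fc).
    by move=> [].
  exists (c *c a0) => // a G x Fa /ldividesP [b]; rewrite dom_ccomp // => a0b aE.
  have cb : dom c = tgt (a0 *c b) by rewrite tgt_ccomp.
  rewrite -ccompA // in aE; rewrite {}aE in Fa *.
  move=> dG Ga; rewrite (ldquot_comp F cb) (ldquot_comp G cb) => lF lG Gcd.
  have Gc : G c by apply: dfilter_down dG _ Ga; exact: ldivides_compl.
  apply: (h (a0 *c b) (ldquot c G) x) => //; first exact: ldivides_compl.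
  exact: dfilter_ldquot.
Qed.

End Letters.

(** * From closed invariant families to pairs *)

Section Correspondence.
Variables (C : category) (S : set C).
Hypothesis LC : left_cancellative C.
Hypothesis FA : finitely_aligned C.
Hypothesis S_garside : garside S.
Hypothesis S_noninvertible : S `&` invertible C = set0.
Hypothesis S_transverse : transverse S.
Hypothesis S_locally_bounded : locally_bounded S.
Implicit Types a b c r s t x y z : C.
Implicit Types (F G : set C) (Y : set (set C)).

Local Notation letter := (letter S).
Local Notation garside_ninv := (garside_ninv LC S_noninvertible).
Local Notation letter_object := (letter_object LC S_noninvertible).
Local Notation letter_unique := (letter_unique LC S_noninvertible S_transverse).
Local Notation letter_exists := (letter_exists S_garside S_locally_bounded).
Local Notation lshift_letter := (lshift_letter LC S_garside S_locally_bounded).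

Lemma letter_max F x r : division_filter F -> letter F x -> (S `|` objects C) r ->
  F r -> r <=| x.
Proof.
move=> dF [Fx _ hx] [Sr|/object_tgt ro] Fr; first exact: hx.
by rewrite -ro (dfilter_tgt dF Fr Fx); exact: tgt_ldivides.
Qed.

Lemma letter_lshift_invertible F x u :
  division_filter F -> letter F x -> objects C x -> F (dom u) ->
  invertible C u -> letter (lshift u F) (tgt u).
Proof.
move=> dF lx ox Fu iu; have [Fx _ _] := lx; have ux := dfilter_dom dF Fu Fx.
split; first by exists x; rewrite -(tgt_ccomp ux); split=> //; exact: tgt_ldivides.
  by right; exact: objects_tgt.
move=> r Sr Fr; have := lshift_letter dF lx Fu Sr Fr => /(garside_ninv Sr) [].
by apply: invertible_comp => //; exact: object_invertible.
Qed.

Lemma letter_of_head F x d h : division_filter F -> letter F x -> F (dom d) ->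
  is_head S (d *c x) h -> letter (lshift d F) h.
Proof.
move=> dF lx Fd [Sh hdx hmax]; have [Fx _ _] := lx.
split; [exists x; split=> //; exact: dfilter_dom Fx|by left|].
by move=> r Sr Fr; apply: hmax => //; exact: lshift_letter lx _ _ _.
Qed.

Lemma head_of_letter F x d h : division_filter F -> letter F x -> F (dom d) ->
  S h -> letter (lshift d F) h -> is_head S (d *c x) h.
Proof.
move=> dF lx Fd Sh [Fh _ hmax]; have [Fx _ _] := lx.
split=> //; first exact: lshift_letter lx _ _ _.
move=> r Sr rdx; apply: hmax => //; exists x; split=> //; exact: dfilter_dom Fx.
Qed.

(** The set of the letters of the filters of [Y]. *)
Definition letters_of Y : set C :=
  [set x | exists F, [/\ division_filter F, Y F & letter F x]].

(** The set of the filters all of whose successive letters are in [L]. *)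
Definition filters_spelled (L : set C) : set (set C) :=
  [set F | division_filter F /\
    forall a, F a -> exists2 x, letter (ldquot a F) x & L x].

Lemma filters_spelled_letters Y : closed_invariant_family Y ->
  filters_spelled (letters_of Y) = Y.
Proof.
move=> [Yd Ycl [Yq Ys]]; rewrite predeqE => F; split=> [[dF lF]|YF]; last first.
  split=> [|a Fa]; first exact: Yd.
  have dFa := dfilter_ldquot LC (Yd _ YF) Fa.
  have [x lx] := letter_exists dFa.
  by exists x => //; exists (ldquot a F); split=> //; exact: Yq.
apply: Ycl => // A finA.
(* If good c a, then a decides whether c is in a filter that contains a and
   continues like F after a. *)
pose good c a := (F c -> c <=| a) /\
  (~ F c -> forall G x, F a -> division_filter G -> G a ->
     letter (ldquot a F) x -> letter (ldquot a G) x -> ~ G c).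
have tF := tails_filter dF.
have [|a Fa goodA] := @filter_finite_bigcap _ _ (tails F) A good _ finA.
  move=> c Ac; have [Fc|nFc] := pselect (F c).
    by exists c => // a [Fa ca]; split.
  have [a0 Fa0 h] := far_letter_notin LC S_garside S_locally_bounded dF nFc.
  by exists a0 => // a [Fa a0a]; split=> // _ G x _; exact: (h a G x Fa a0a).
have [x lx [G [dG YG lG]]] := lF _ Fa; have [[ax _] _ _] := lx; have [Gx _ _] := lG.
have Ga : G (dom a) by rewrite ax; exact: dfilter_F_tgt dG Gx.
have dG' : division_filter (lshift a G) by exact: dfilter_lshift.
have G'a : lshift a G a.
  by exists (dom a); rewrite tgt_dom ccompc1; split=> //; exact: ldivides_refl.
exists (lshift a G); first exact: Ys.
move=> c Ac; have [|Fgood nFgood] := goodA a _ c Ac.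
  by split=> //; exact: ldivides_refl.
split=> [G'c|Fc]; last by apply: dfilter_down dG' _ G'a; exact: Fgood.
apply: contrapT => nFc; apply: (nFgood nFc (lshift a G) x) => //.
by rewrite ldquot_lshift.
Qed.

Section FamilyToPair.
Variable Y : set (set C).
Hypothesis Yci : closed_invariant_family Y.
Let T := S `&` letters_of Y.
Let D := objects C `&` letters_of Y.

Lemma letters_of_pair : letters_of Y = T `|` D.
Proof.
rewrite /T /D -setIUl; apply/esym/setIidr => x [F [_ _ []]] //.
Qed.

Lemma letters_of_admissible : admissible S T D.
Proof.
move=> t [St [F [dF YF lt]]]; have [Ft _ ht] := lt; have [_ _ [Yq _]] := Yci.
have dF' := dfilter_ldquot LC dF Ft; have [t' lt'] := letter_exists dF'.
have Lt' : letters_of Y t' by exists (ldquot t F); split=> //; exact: Yq.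
have [[tt' Ftt'] [St'|ot'] _] := lt'; [left|right].
  exists t' => //; split=> //=.
    by split; exact: S_sharp.
  by split=> // r Sr rtt'; apply: ht => //; exact: dfilter_down rtt' Ftt'.
by rewrite tt' (object_tgt ot').
Qed.

Lemma letters_of_H_invariant : H_invariant S T D.
Proof.
have [_ _ [_ Ys]] := Yci.
split=> [a x nia|u x iu [ox [F [dF YF lx]]] ux].
  rewrite -letters_of_pair => -[F [dF YF lx]] ax; have [Fx _ _] := lx.
  have Fa : F (dom a) by rewrite ax; exact: dfilter_F_tgt dF Fx.
  have dF' := dfilter_lshift dF Fa; have [h lh] := letter_exists dF'.
  have [//|[s Ss sa]] := invertible_or_S_ldivides LC S_garside S_noninvertible a.
  have Sh : S h.
    apply: (letter_dom LC S_noninvertible lh (r := s)) => //.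
    exists (dom a); rewrite tgt_dom ccompc1; split=> //.
  exists h; first exact: head_of_letter lx _ _ _.
  by split=> //; exists (lshift a F); split=> //; exact: Ys.
have [Fx _ _] := lx.
have Fu : F (dom u) by rewrite ux; exact: dfilter_F_tgt dF Fx.
split; first exact: objects_tgt.
exists (lshift u F); split; [exact: dfilter_lshift|exact: Ys|].
exact: letter_lshift_invertible lx _ _ _.
Qed.

Lemma letters_of_max_closed : max_closed S T D.
Proof.
have [Yd Ycl _] := Yci.
move=> t_ s Tt lim_t; rewrite -letters_of_pair.
have [F_ F_P] := choice (fun i => (Tt i).2).
(* F is the limit of the filters F_i along the ultrafilter U. *)
have [U [UU leU]] := @ultraFilterLemma nat \oo _.
have Unot (A : set nat) : ~ U A -> U (~` A) by case: (in_ultra_setVsetC A UU).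
pose F : set C := [set c | U [set i | F_ i c]].
have dF_ i : division_filter (F_ i) by case: (F_P i).
have [[Ds s_t] maxs] := lim_t id (fun i j ij => ij).
have Fs : F s.
  apply: filterS (leU _ s_t) => i /= sti; have [_ _ [Ft _ _]] := F_P i.
  exact: dfilter_down sti Ft.
have dF : division_filter F.
  split; first by exists s.
    by move=> a b ab; apply: filterS => i; exact: dfilter_down.
  move=> a b Fa Fb; have [K [finK KE]] := FA a b.
  suff [c Kc Fc] : exists2 c, K c & F c.
    have [] : (rideal a `&` rideal b) c; last by exists c.
    by rewrite KE; exists c => //; exact: ldivides_refl.
  apply: contrapT => noK.
  have UK : U (\bigcap_(c in K) [set i | ~ F_ i c]).
    apply: filter_finite_bigcap => // c Kc; apply: Unot => Fc.
    by apply: noK; exists c.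
  have [i [[Fia Fib] nK]] := filter_ex (filterI (filterI Fa Fb) UK).
  have [w [Fw aw bw]] := dfilter_ub (dF_ i) Fia Fib.
  have : (rideal a `&` rideal b) w by [].
  rewrite KE => -[c Kc cw]; apply: (nK c Kc); exact: dfilter_down cw Fw.
have YF : Y F.
  apply: Ycl => // A finA.
  have UA : U (\bigcap_(c in A) [set i | F_ i c <-> F c]).
    apply: filter_finite_bigcap => // c Ac; have [Fc|nFc] := pselect (F c).
      by apply: (filterS _ Fc) => i /= Fic; split.
    by apply: filterS (Unot _ nFc) => i /= nFic; split.
  have [i Ai] := filter_ex UA; exists (F_ i); last by move=> c /Ai.
  by case: (F_P i).
have [x lx] := letter_exists dF; have [Fx Dx _] := lx.
suff -> : s = x by exists F.
have sx : s <=| x by exact: letter_max lx Ds Fs.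
case: Dx => [Sx|ox]; last first.
  case: Ds => [Ss|os]; first by case: (letter_object lx ox Ss).
  by rewrite -(object_tgt os) -(object_tgt ox); exact: dfilter_tgt Fs Fx.
(* The letter x of F divides the terms of a subsequence, of which s is a
   maximal divisor. *)
have [|phi [phi_incr xphi]] := @frequently_subsequence (fun i => x <=| t_ i).
  move=> N; have UN : U [set i | (N < i)%N] by apply: leU; exists N.+1.
  have [i [Fix Ni]] := filter_ex (filterI Fx UN); exists i; split=> //.
  by have [_ _ [_ _]] := F_P i; exact.
have xs : x <=| s.
  apply: contrapT => nxs; have [_ /(_ x)] := lim_t phi phi_incr.
  case; first by split; [left|apply: nearW => i; exact: xphi].
  split; first by move=> y; exact: ldivides_trans.
  by move=> /(_ s (ldivides_refl s)).
case: Ds => [Ss|os]; last first.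
  case: (garside_ninv Sx xs); exact: object_invertible.
by apply: S_transverse => //; exact: ldivides_anti.
Qed.

End FamilyToPair.

(** * From pairs to closed invariant families *)

Section PairToFamily.
Hypothesis C_countable : countable [set: C].
Variables T D : set C.
Hypothesis TS : T `<=` S.
Hypothesis DO : D `<=` objects C.
Hypothesis TD_adm : admissible S T D.
Hypothesis TD_inv : H_invariant S T D.
Hypothesis TD_max : max_closed S T D.
Let L := T `|` D.

(** The [H]-invariance of [(T, D)], in terms of letters. *)
Lemma letter_lshift_in F x d : division_filter F -> letter F x -> L x ->
  (T x -> exists2 y, letter (ldquot x F) y & L y) -> F (dom d) ->
  exists2 y, letter (lshift d F) y & L y.
Proof.
have noninv G y e : division_filter G -> letter G y -> L y -> G (dom e) ->
    ~ invertible C e -> exists2 h, letter (lshift e G) h & L h.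
  move=> dG lG Ly Ge nie; have [Gy _ _] := lG.
  have [h hh Th] := TD_inv.1 e y nie Ly (dfilter_dom dG Ge Gy).
  by exists h; [exact: letter_of_head hh|left].
move=> dF lx Lx Txq Fd; have [Fx _ _] := lx; have dx := dfilter_dom dF Fd Fx.
have [id_|nid] := pselect (invertible C d); last exact: noninv lx _ _ _.
case: Lx => [Tx|Dx]; last first.
  exists (tgt d); first by apply: letter_lshift_invertible lx _ _ _ => //; exact: DO.
  by right; exact: TD_inv.2 Dx dx.
(* H-invariance does not apply to the invertible d, but d F = (d x) (x^-1 F) and
   d x is not invertible. *)
have [y ly Ly] := Txq Tx.
have dq := dfilter_ldquot LC dF Fx.
have qx : ldquot x F (dom x) := ldquot_dom Fx.
have -> : lshift d F = lshift (d *c x) (ldquot x F).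
  by rewrite lshift_comp // lshift_ldquot.
apply: noninv ly Ly _ _ => //; first by rewrite dom_ccomp.
by move=> /(invertible_compr LC dx); apply: garside_ninv (ldivides_refl x); exact: TS.
Qed.

Lemma ldquot_lshift_comp F a b c d : division_filter F -> F b ->
  dom a = tgt b -> dom c = tgt d -> a *c b = c *c d ->
  ldquot c (lshift a F) = lshift d (ldquot b F).
Proof.
move=> dF Fb ab cd e; have dq := dfilter_ldquot LC dF Fb.
have qb : ldquot b F (dom b) := ldquot_dom Fb.
have qd : ldquot b F (dom d) by rewrite -(dom_ccomp cd) -e dom_ccomp.
rewrite -{1}(lshift_ldquot dF Fb) -lshift_comp // e lshift_comp //.
rewrite ldquot_lshift //; first exact: dfilter_lshift.
by exists (dom d); rewrite tgt_dom ccompc1 cd; split=> //; exact: tgt_ldivides.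
Qed.

Lemma filters_spelled_invariant : finvariant (filters_spelled L).
Proof.
split=> [F a [dF lF] Fa|F a [dF lF] Fa].
  split=> [|b [ab Fab]]; first exact: dfilter_ldquot.
  by rewrite -ldquot_comp //; exact: lF.
split=> [|c [b [Fb ab /ldividesP [d cd abE]]]]; first exact: dfilter_lshift.
rewrite (ldquot_lshift_comp dF Fb ab cd abE).
have dq := dfilter_ldquot LC dF Fb.
have [x lx Lx] := lF b Fb; have [[bx Fbx] _ _] := lx.
apply: letter_lshift_in lx Lx _ _ => //.
  by move=> Tx; rewrite -ldquot_comp //; exact: lF.
by rewrite -(dom_ccomp cd) -abE dom_ccomp //; exact: ldquot_dom.
Qed.

Lemma filters_spelled_closed : fclosed (filters_spelled L).
Proof.
have [f f_inj] := elimT (countable_injP _) C_countable.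
move=> F dF apx; split=> // a Fa.
(* The filter G n agrees with F on the elements whose index is below n. *)
have [|G GP] := @choice nat (set C) (fun n G => filters_spelled L G /\
    forall c, (f c < n)%N -> G c <-> F c).
  move=> n.
  have [|G LG GF] := apx (f @^-1` `I_n); last by exists G.
  by apply: finite_preimage => // x y _ _; apply: f_inj; rewrite inE.
have dFa := dfilter_ldquot LC dF Fa.
have [x lx] := letter_exists dFa; exists x => //.
have [[ax Fax] Dx _] := lx.
have [|t tP] := @choice nat C (fun n t => (f a < n)%N ->
    letter (ldquot a (G n)) t /\ L t).
  move=> n; have [an|_] := boolP (f a < n)%N; last by exists a.
  have [[dG lG] GF] := GP n; have [|y ly Ly] := lG a; first exact/GF.
  by exists y.
have Ga n : (f a < n)%N -> G n a by move=> an; exact/((GP n).2 a an).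
have at_ n : (f a < n)%N -> dom a = tgt (t n) by move=> /tP [[[]]].
have divE r n : (f a < n)%N -> (f (a *c r) < n)%N -> dom a = tgt r ->
    (S `|` objects C) r -> r <=| t n <-> ldquot a F r.
  move=> an arn ar Dr; have [ln _] := tP n an.
  have dG : division_filter (ldquot a (G n)).
    by apply: dfilter_ldquot => //; [case: (GP n) => -[]|exact: Ga].
  split=> [rt|[_ /((GP n).2 _ arn) Gar]]; last by apply: letter_max ln _ _.
  have [Gt _ _] := ln; have [_ Gar] := dfilter_down dG rt Gt.
  by split=> //; exact/((GP n).2 _ arn).
(* If infinitely many letters t n are in T, then x is the limit of those; if
   not, almost all are in D, hence equal to the object dom a = x. *)
have [freq|nfreq] := pselect
  (forall N, exists i, (N < i)%N /\ ((f a < i)%N /\ T (t i))).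
  have [phi [phi_incr phiP]] := frequently_subsequence freq.
  apply: (@TD_max (t \o phi)) => [i|psi psi_incr]; first exact: (phiP i).2.
  have psi_ge i : (i <= phi (psi i))%N.
    exact: leq_trans (increasing_ge psi_incr i) (increasing_ge phi_incr _).
  split; first split=> //.
    exists (f (a *c x)).+1 => // i /= xi.
    by apply/divE => //; [exact: (phiP _).1|exact: leq_trans (psi_ge i)].
  move=> r [Dr [N _ Nr]] [_ nrx]; apply: nrx => y; apply: ldivides_trans.
  pose i := maxn N (f (a *c r)).+1.
  have rti : r <=| t (phi (psi i)) by apply: Nr; exact: leq_maxl.
  have ar : dom a = tgt r.
    by rewrite (ldivides_tgt rti); apply: at_; exact: (phiP _).1.
  apply: (letter_max dFa lx Dr); apply: (iffLR (divE r _ _ _ ar Dr) rti).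
    exact: (phiP _).1.
  by apply: leq_trans (psi_ge i); exact: leq_maxr.
have [M MP] : exists M, forall i, (M < i)%N -> (f a < i)%N -> ~ T (t i).
  apply: contrapT => noN; apply: nfreq => N; apply: contrapT => nN; apply: noN.
  by exists N => i Ni ai Ti; apply: nN; exists i; split.
pose n := (maxn M (maxn (f a) (f (a *c x)))).+1.
have [Mn an axn] : [/\ (M < n)%N, (f a < n)%N & (f (a *c x) < n)%N].
  by rewrite /n !ltnS !leq_max !leqnn !orbT.
have [ln [/(MP n Mn an) //|Dt]] := tP n an.
have ot : objects C (t n) by exact: DO.
have xt : x <=| t n by exact/divE.
case: Dx => [Sx|ox].
  by case: (garside_ninv Sx xt); exact: object_invertible.
by right; rewrite -(object_tgt ox) -ax (at_ n an) (object_tgt ot).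
Qed.

Lemma filters_spelled_family : closed_invariant_family (filters_spelled L).
Proof.
split; [by move=> F []|exact: filters_spelled_closed|exact: filters_spelled_invariant].
Qed.

(** Every letter in [L] begins an infinite path in [L] any two successive
    entries [t t'] of which satisfy the greediness condition; after an object
    the path is constant. *)
Lemma next_letter : exists next : C -> C, forall t, L t ->
  [/\ L (next t), dom t = tgt (next t) &
      forall r, S r -> r <=| t *c next t -> r <=| t].
Proof.
have [|next nextP] := @choice C C (fun t t' => L t -> [/\ L t', dom t = tgt t' &
  forall r, S r -> r <=| t *c t' -> r <=| t]); last by exists next.
move=> t; have [[Tt|Dt]|nLt] := pselect (L t); last by exists t.
  have [[t' Tt' [[tt' _] _ [greedy_t _]]]|Dt] := TD_adm Tt.
    by exists t' => _; split=> //; left.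
  by exists (dom t) => _; split; [right|rewrite tgt_dom|rewrite ccompc1].
have ot := DO Dt; exists t => _; split; first by right.
  by rewrite object_tgt.
by move=> r Sr; rewrite -[X in _ *c X]ot ccompc1.
Qed.

Section InfinitePath.
Variable next : C -> C.
Hypothesis nextP : forall t, L t -> [/\ L (next t), dom t = tgt (next t) &
  forall r, S r -> r <=| t *c next t -> r <=| t].

(** The product of the first [n.+1] entries of the path [t, next t, ...]. *)
Fixpoint path_upto t n : C :=
  if n is n'.+1 then t *c path_upto (next t) n' else t.

(** The left divisors of the products of the initial segments of the path. *)
Definition path_filter t : set C := [set y | exists n, y <=| path_upto t n].

Lemma L_next t : L t -> L (next t).
Proof. by move=> /nextP []. Qed.

Lemma L_iter n t : L t -> L (iter n next t).
Proof. by move=> Lt; elim: n => //= n; exact: L_next. Qed.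

Lemma tgt_path_upto t n : L t -> tgt (path_upto t n) = tgt t.
Proof.
elim: n t => //= n IHn t Lt; have [Lt' tt' _] := nextP Lt.
by rewrite tgt_ccomp // IHn.
Qed.

Lemma path_upto_composable t n : L t -> dom t = tgt (path_upto (next t) n).
Proof. by move=> /nextP [Lt' tt' _]; rewrite tgt_path_upto. Qed.

Lemma path_upto_mono t m n : L t -> (m <= n)%N -> path_upto t m <=| path_upto t n.
Proof.
elim: m n t => [|m IHm] [|n] t Lt //= mn; try exact: ldivides_refl.
  by apply: ldivides_compl; exact: path_upto_composable.
apply: ldivides_comp2l; first exact: path_upto_composable.
by apply: IHm => //; exact: L_next.
Qed.

Lemma path_filter_dfilter t : L t -> division_filter (path_filter t).
Proof.
move=> Lt; split.
- by exists t, 0%N; exact: ldivides_refl.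
- by move=> a b ab [n bn]; exists n; exact: ldivides_trans bn.
- move=> a b [m am] [n bn]; exists (path_upto t (maxn m n)); split.
  + by exists (maxn m n); exact: ldivides_refl.
  + by apply: ldivides_trans am _; apply: path_upto_mono => //; exact: leq_maxl.
  + by apply: ldivides_trans bn _; apply: path_upto_mono => //; exact: leq_maxr.
Qed.

Lemma ldquot_path_filter t : L t -> ldquot t (path_filter t) = path_filter (next t).
Proof.
move=> Lt; rewrite predeqE => z; split=> [[tz [n tzn]]|[n zn]].
  exists n; apply: (ldivides_cancel LC tz) => //; first exact: path_upto_composable.
  by apply: ldivides_trans tzn _; exact: (path_upto_mono Lt (leqnSn n)).
have tz : dom t = tgt z by rewrite (ldivides_tgt zn); exact: path_upto_composable.
by split=> //; exists n.+1; exact: ldivides_comp2l.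
Qed.

(** Greediness of successive entries propagates to the whole path. *)
Lemma S_ldivides_path_upto t n r : L t -> S r -> r <=| path_upto t n -> r <=| t.
Proof.
elim: n t r => // n IHn t r Lt Sr /= rt; have [Lt' tt' greedy_t] := nextP Lt.
apply: greedy_t => //; set b := path_upto (next t) n in rt.
have tb : dom t = tgt b by exact: path_upto_composable.
(* The left divisors of b form a filter whose letter is the second entry. *)
have dF : division_filter [set y | y <=| b].
  split; first by exists b; exact: ldivides_refl.
    by move=> x y; exact: ldivides_trans.
  by move=> x y xb yb; exists b; split=> //; exact: ldivides_refl.
apply: (lshift_letter dF) => //.
- split; first exact: (path_upto_mono Lt' (leq0n n)).
    by case: Lt' => [/TS|/DO]; [left|right].
  by move=> s Ss; exact: IHn.
- by rewrite /= tb; exact: tgt_ldivides.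
- by exists b; split=> //; exact: ldivides_refl.
Qed.

Lemma path_filter_letter t : L t -> letter (path_filter t) t.
Proof.
move=> Lt; split; first by exists 0%N; exact: ldivides_refl.
  by case: Lt => [/TS|/DO]; [left|right].
by move=> r Sr [n]; exact: S_ldivides_path_upto.
Qed.

Lemma dom_path_upto t n : L t -> dom (path_upto t n) = tgt (iter n.+1 next t).
Proof.
elim: n t => [|n IHn] t Lt; first by case: (nextP Lt).
by rewrite /= dom_ccomp ?IHn -?iterSr //; [exact: L_next|exact: path_upto_composable].
Qed.

(** The filter of a path is the product of its first [n.+1] entries with the
    filter of the remaining path. *)
Lemma path_filterE t n : L t ->
  path_filter t = lshift (path_upto t n) (path_filter (iter n.+1 next t)).
Proof.
have shift u : L u -> path_filter u = lshift u (path_filter (next u)).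
  move=> Lu; rewrite -ldquot_path_filter // lshift_ldquot //.
    exact: path_filter_dfilter.
  by exists 0%N; exact: ldivides_refl.
elim: n t => [|n IHn] t Lt; first exact: shift.
have Lt' := L_next Lt; have Lit : L (iter n.+1 next (next t)) by exact: L_iter.
rewrite (iterSr n.+1) [LHS]shift // (IHn _ Lt').
rewrite -[path_upto t n.+1]/(t *c path_upto (next t) n) lshift_comp //.
- exact: path_filter_dfilter.
- by rewrite dom_path_upto //; exists 0%N; exact: tgt_ldivides.
- exact: path_upto_composable.
Qed.

Lemma path_filter_spelled t : L t -> filters_spelled L (path_filter t).
Proof.
move=> Lt; split=> [|b [n /ldividesP [d bd pE]]]; first exact: path_filter_dfilter.
set t' := iter n.+1 next t; have Lt' : L t' by exact: L_iter.
have dF' := path_filter_dfilter Lt'.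
have F'd : path_filter t' (dom d).
  rewrite -(dom_ccomp bd) -pE dom_path_upto // -/t'.
  by exists 0%N; exact: tgt_ldivides.
rewrite (path_filterE n Lt) -/t' pE lshift_comp // ldquot_lshift //; last first.
- by exists (dom d); rewrite tgt_dom ccompc1 bd; split=> //; exact: tgt_ldivides.
- exact: dfilter_lshift.
apply: letter_lshift_in (path_filter_letter Lt') _ _ _ => // _.
rewrite ldquot_path_filter //; exists (next t'); last exact: L_next.
by apply: path_filter_letter; exact: L_next.
Qed.

End InfinitePath.

Lemma letters_of_filters_spelled : letters_of (filters_spelled L) = L.
Proof.
rewrite predeqE => x; split=> [[F [dF [_ lF] lx]]|Lx].
  have [Fx _ _] := lx; have Ft := dfilter_F_tgt dF Fx.
  have [y] := lF _ Ft; rewrite ldquot_object //; last exact: objects_tgt.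
  by move=> /(letter_unique dF lx) ->.
have [next nextP] := next_letter; exists (path_filter next x); split.
- exact: path_filter_dfilter.
- exact: path_filter_spelled.
- exact: path_filter_letter.
Qed.

End PairToFamily.

End Correspondence.

(** * The correspondence *)

Theorem theorem2 (C : category) (S : set C)
  (C_countable : countable [set: C])
  (C_left_cancellative : left_cancellative C)
  (C_finitely_aligned : finitely_aligned C)
  (S_garside : garside S)
  (S_noninvertible : S `&` invertible C = set0)
  (S_transverse : transverse S)
  (S_locally_bounded : locally_bounded S) :
  exists Phi : set (Jmap C) -> set C * set C,
    set_bij
      [set X : set (Jmap C) | closed_invariant X]
      [set TD : set C * set C |
        [/\ TD.1 `<=` S, TD.2 `<=` objects C, admissible S TD.1 TD.2,
            H_invariant S TD.1 TD.2 & max_closed S TD.1 TD.2]]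
      Phi.
Proof.
pose LX (X : set (Jmap C)) := letters_of S (filters_of X).
have family (X : set (Jmap C)) :
    closed_invariant X -> closed_invariant_family (filters_of X).
  exact: (filters_of_family C_left_cancellative C_finitely_aligned).
exists (fun X => (S `&` LX X, objects C `&` LX X)); split.
- move=> X /family Xci /=; split.
  + exact: subIsetl.
  + exact: subIsetl.
  + by apply: letters_of_admissible.
  + by apply: letters_of_H_invariant.
  + by apply: letters_of_max_closed.
- have LXK (X : set (Jmap C)) : closed_invariant X ->
      @char_of C @` filters_spelled S (LX X) = X.
    move=> Xci; have [XO _ _] := Xci.
    rewrite filters_spelled_letters //; last exact: family.
    by apply: char_of_filters.
  move=> X X'; rewrite !inE => Xci X'ci [eS eO].
  rewrite -(LXK _ Xci) -(LXK _ X'ci).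
  by rewrite /LX letters_of_pair [in RHS]letters_of_pair -/(LX X) -/(LX X') eS eO.
- move=> [T D] /= [TS DO adm inv maxc].
  exists (@char_of C @` filters_spelled S (T `|` D)).
    by apply: family_closed_invariant => //; by apply: filters_spelled_family.
  have -> : LX (@char_of C @` filters_spelled S (T `|` D)) = T `|` D.
    rewrite /LX filters_ofK; first by apply: letters_of_filters_spelled.
    by move=> F [].
  have SO (x : C) : S x -> objects C x -> False.
    exact: (S_not_object C_left_cancellative S_noninvertible).
  congr pair; rewrite predeqE => x; split.
  + by move=> [Sx [//|/DO /(SO _ Sx)]].
  + by move=> Tx; split; [exact: TS|left].
  + by move=> [ox [/TS /SO/(_ ox)|]].
  + by move=> Dx; split; [exact: DO|right].
Qed.
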